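(* Let $D\subset\mathbb{R}^{2}$ be a compact convex domain with $C^{1}$ boundary, let $[a,b]\subset\mathbb{R}$ be a compact interval with $a<b$, and let \[ F:D\times[a,b]\to\mathbb{R}^{2},\qquad G:D\times[a,b]\to\mathbb{R} \] be continuous maps satisfying: (1) $F(x,s)\cdot\nu_D(x)>0$ for all $x\in\partial D$ and $s\in[a,b]$, where $\nu_D(x)$ denotes the outward unit normal vector to $\partial D$ at $x$; (2) $F(x,a)=F(x,b)$ for all $x\in D$; (3) for every $x\in D$, if $G(x,a)=0$, then $G(x,b)=0$; (4) for every $x\in D$, if $G(x,a)\neq0$, then $G(x,a)\,G(x,b)<0$. Then there exists $(\bar{x},\bar{s})\in D\times[a,b]$ such that $F(\bar{x},\bar{s})=0$ and $G(\bar{x},\bar{s})=0$.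
   Context: A compact domain in $\mathbb{R}^2$ means the closure of a nonempty bounded connected open set; $\cdot$ is the Euclidean inner product. *)

(* Defs.v *)
From HB Require Import structures.
From mathcomp Require Import all_boot all_order all_algebra.
From mathcomp Require Import all_classical all_reals all_analysis.
From mathcomp Require Import ring lra.

Set Implicit Arguments.
Unset Strict Implicit.
Unset Printing Implicit Defensive.

Import Order.TTheory GRing.Theory Num.Theory.
Import numFieldNormedType.Exports.

Local Open Scope classical_set_scope.
Local Open Scope ring_scope.

Section Definitions.
Context {R : realType}.
Implicit Types (D : set 'rV[R]_2) (p u v e n : 'rV[R]_2) (g : R -> R).

Definition dot u v : R := \sum_(i < 2) u 0 i * v 0 i.

(* The norm of 'rV[R]_2 is the sup norm; it induces the usual topology and
   the usual bounded sets of the plane. *)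
Definition compact_domain D : Prop :=
  exists U : set 'rV[R]_2,
    [/\ U !=set0, bounded_set U, connected U, open U & D = closure U].

Definition boundary D : set 'rV[R]_2 := closure D `\` interior D.

Definition C1_function g : Prop :=
  (forall t, derivable g t 1) /\ continuous (derive1 g).

(* In the orthonormal frame (e, n) centered at p, the set D coincides near p
   with the closed region below the graph of a C^1 function g. When p is a
   boundary point this forces g 0 = 0. *)
Definition local_C1_subgraph D p e n g : Prop :=
  [/\ dot e e = 1, dot n n = 1, dot e n = 0, C1_function g &
      \forall y \near p, D y <-> dot (y - p) n <= g (dot (y - p) e)].

Definition C1_boundary D : Prop :=
  forall p, boundary D p -> exists e n g, local_C1_subgraph D p e n g.

(* e + g'(0) n spans the tangent line at p of the boundary curve, that is, of
   the graph of g in the frame (e, n). *)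
Definition is_outward_unit_normal D p v : Prop :=
  [/\ dot v v = 1,
      exists e n g, local_C1_subgraph D p e n g /\
        dot v (e + derive1 g 0 *: n) = 0 &
      \forall t \near 0^'+, ~ D (p + t *: v)].

(* The value 0 is a default, never used when D is closed with C^1 boundary and p is one
   of its boundary points: see outward_unit_normal_spec and
   is_outward_unit_normal_unique. *)
Definition outward_unit_normal D p : 'rV[R]_2 :=
  xget 0 (is_outward_unit_normal D p).

End Definitions.

Section OutwardNormal.
Context {R : realType}.
Implicit Types (D : set 'rV[R]_2) (p u v d e n : 'rV[R]_2) (g : R -> R).

Lemma dotE u v : dot u v = u 0 0 * v 0 0 + u 0 1 * v 0 1.
Proof.
rewrite /dot big_ord_recl big_ord1.
by congr (_ + u 0 _ * v 0 _); exact/val_inj.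
Qed.

Lemma rV2P u v : u 0 0 = v 0 0 -> u 0 1 = v 0 1 -> u = v.
Proof.
move=> h0 h1; apply/rowP => -[[|[|//]] hi].
  by have -> : Ordinal hi = 0 by exact/val_inj.
by have -> : Ordinal hi = 1 by exact/val_inj.
Qed.

Lemma deriv_gt0_right (h : R -> R) (l : R) : h 0 = 0 ->
  is_derive (0 : R) (1 : R) h l -> 0 < l -> \forall t \near 0^'+, 0 < h t.
Proof.
move=> h0 hl l0.
have dh : derivable h 0 1 by exact: ex_derive.
have {}hl : 'D_1 h 0 = l by exact: derive_val.
have H : (fun t : R => t^-1 *: ((h \o shift 0) (t *: (1 : R)) - h 0)) @ 0^' --> l.
  by rewrite -hl; exact: dh.
have {}H := cvgr_gt _ (cvg_dnbhs_at_right H) _ l0.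
near=> t.
have t0 : 0 < t by near: t; exact: nbhs_right_gt.
have : 0 < t^-1 *: ((h \o shift 0) (t *: (1 : R)) - h 0).
  by near: t; exact: H.
by rewrite h0 subr0 /= addr0 /GRing.scale /= mulr1 pmulr_rgt0 ?invr_gt0.
Unshelve. all: by end_near. Qed.

Lemma dot_frame e n u v : dot e e = 1 -> dot n n = 1 -> dot e n = 0 ->
  dot u v = dot u e * dot v e + dot u n * dot v n.
Proof.
rewrite !dotE.
move: (e 0 0) (e 0 1) (n 0 0) (n 0 1) (u 0 0) (u 0 1) (v 0 0) (v 0 1).
move=> e0 e1 n0 n1 u0 u1 v0 v1 ee nn en.
pose k := e0 * n1 - e1 * n0.
have n0E : n0 = - k * e1.
  have -> : n0 = n0 * (e0 * e0 + e1 * e1) - e0 * (e0 * n0 + e1 * n1).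
    by rewrite ee en; ring.
  by rewrite /k; ring.
have n1E : n1 = k * e0.
  have -> : n1 = n1 * (e0 * e0 + e1 * e1) - e1 * (e0 * n0 + e1 * n1).
    by rewrite ee en; ring.
  by rewrite /k; ring.
have kk : k * k = 1.
  by rewrite -nn n0E n1E -[LHS]mulr1 -ee; ring.
rewrite n0E n1E.
have -> : (u0 * e0 + u1 * e1) * (v0 * e0 + v1 * e1) +
    (u0 * (- k * e1) + u1 * (k * e0)) * (v0 * (- k * e1) + v1 * (k * e0)) =
    (u0 * e0 + u1 * e1) * (v0 * e0 + v1 * e1) +
    (k * k) * (u1 * e0 - u0 * e1) * (v1 * e0 - v0 * e1) by ring.
by rewrite kk mul1r -[LHS]mulr1 -ee; ring.
Qed.

Lemma local_C1_subgraph_ray D p e n g d :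
  local_C1_subgraph D p e n g -> g 0 = 0 ->
  (dot d n < derive1 g 0 * dot d e -> \forall t \near 0^'+, D (p + t *: d)) /\
  (derive1 g 0 * dot d e < dot d n -> \forall t \near 0^'+, ~ D (p + t *: d)).
Proof.
move=> [_ _ _ [dg _] Dg] g0.
have ptd : (fun t : R => p + t *: d) @ 0^'+ --> p.
  apply: cvg_at_right_filter.
  suff : (fun t : R => p + t *: d) @ (0 : R) --> p + 0 *: d.
    by rewrite scale0r addr0.
  apply: cvgD; first exact: cvg_cst.
  by apply: (@cvgZr_tmp R 'rV[R]_2 R (nbhs (0 : R)) _ id 0 d); exact: cvg_id.
have {}Dg : \forall t \near 0^'+,
    D (p + t *: d) <-> t * dot d n <= g (t * dot d e).
  have H : \forall t \near 0^'+, D (p + t *: d) <->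
    dot (p + t *: d - p) n <= g (dot (p + t *: d - p) e) by exact: ptd Dg.
  have E t u : dot (p + t *: d - p) u = t * dot d u.
    by rewrite !dotE !mxE; ring.
  near=> t; rewrite -!E; near: t; exact: H.
set h := fun t : R => g (t * dot d e) - t * dot d n.
have h0 : h 0 = 0 by rewrite /h !mul0r g0 subr0.
have dh : is_derive (0 : R) (1 : R) h (derive1 g 0 * dot d e - dot d n).
  have dl (c : R) : is_derive (0 : R) (1 : R) (fun t : R => t * c) c.
    have -> : (fun t : R => t * c) = c *: (@id R).
      by apply/funext => t; rewrite fctE /GRing.scale /= mulrC.
    by apply: is_derive_eq; rewrite /GRing.scale /= mulr1.
  have dgd : is_derive ((fun t : R => t * dot d e) 0) (1 : R) g (derive1 g 0).
    by rewrite mul0r derive1E; exact/derivableP.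
  have dgl := @is_derive1_comp R g (fun t => t * dot d e) 0 _ _ dgd (dl _).
  exact: is_deriveB dgl (dl _).
split => hd.
  have := deriv_gt0_right h0 dh; rewrite subr_gt0 => /(_ hd) H.
  near=> t.
  have [_ tD] : D (p + t *: d) <-> t * dot d n <= g (t * dot d e) by near: t.
  by apply: tD; rewrite -subr_ge0 ltW //; near: t.
have dNh := is_deriveN dh.
have nh0 : (- h) 0 = 0 by rewrite fctE h0 oppr0.
have := deriv_gt0_right nh0 dNh; rewrite opprB subr_gt0 => /(_ hd) H.
near=> t.
have [Dt _] : D (p + t *: d) <-> t * dot d n <= g (t * dot d e) by near: t.
move=> /Dt; rewrite leNgt => /negP; apply.
rewrite -subr_gt0 -opprB; near: t; exact: H.
Unshelve. all: by end_near. Qed.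

Lemma boundary_subgraph0 D p e n g : closed D -> boundary D p ->
  local_C1_subgraph D p e n g -> g 0 = 0.
Proof.
move=> cD [clDp nDp] [_ _ _ [dg _] Dg].
have Dp : D p by apply: cD.
have d0 (u : 'rV[R]_2) : dot 0 u = 0 by rewrite dotE !mxE !mul0r addr0.
have g0 : 0 <= g 0.
  by have /nbhs_singleton := Dg; rewrite subrr !d0 => -[/(_ Dp)].
apply/eqP; rewrite eq_le g0 andbT leNgt; apply/negP => gp0; apply: nDp.
have cdot (u : 'rV[R]_2) : (fun y => dot (y - p) u) @ p --> 0.
  rewrite (_ : (0 : R) = dot (p - p) u); last by rewrite subrr d0.
  have -> : (fun y => dot (y - p) u) =
    (fun y : 'rV[R]_2 => (y 0 0 - p 0 0) * u 0 0 + (y 0 1 - p 0 1) * u 0 1).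
    by apply/funext => y; rewrite dotE !mxE.
  rewrite dotE !mxE.
  have cy i : (fun y : 'rV[R]_2 => (y 0 i - p 0 i) * u 0 i) @ p -->
      (p 0 i - p 0 i) * u 0 i.
    have c1 : (fun y : 'rV[R]_2 => y 0 i) @ p --> p 0 i.
      exact: coord_continuous.
    have c2 : (fun _ : 'rV[R]_2 => p 0 i) @ p --> p 0 i by exact: (@cvg_cst R (p 0 i) _ (nbhs p)).
    have c3 : (fun _ : 'rV[R]_2 => u 0 i) @ p --> u 0 i by exact: (@cvg_cst R (u 0 i) _ (nbhs p)).
    exact: cvgM (cvgB c1 c2) c3.
  exact: cvgD (cy 0) (cy 1).
have cg : g @ (0 : R) --> g 0.
  by apply: differentiable_continuous; exact/derivable1_diffP.
have cge : (fun y => g (dot (y - p) e) - dot (y - p) n) @ p --> g 0 - 0.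
  have c1 : (fun y => g (dot (y - p) e)) @ p --> g 0.
    by apply: cvg_comp cg; exact: cdot.
  exact: cvgB c1 (cdot n).
have := cvgr_gt _ cge 0; rewrite subr0 => /(_ _ gp0) H.
rewrite /interior /=; near=> y.
have [_ tD] : D y <-> dot (y - p) n <= g (dot (y - p) e) by near: y.
by apply: tD; rewrite -subr_ge0 ltW //; near: y.
Unshelve. all: by end_near. Qed.

Lemma near_right_contra (P : R -> Prop) :
  (\forall t \near 0^'+, P t) -> (\forall t \near 0^'+, ~ P t) -> False.
Proof.
move=> H H'.
have HF : \forall t \near (0 : R)^'+, False.
  near=> t; have nPt : ~ P t by near: t.
  by apply: nPt; near: t.
by have [] := filter_ex HF.
Unshelve. all: by end_near.
Qed.

Lemma is_outward_unit_normal_ray D p v d : closed D -> boundary D p ->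
  is_outward_unit_normal D p v ->
  (dot v d < 0 -> \forall t \near 0^'+, D (p + t *: d)) /\
  (0 < dot v d -> \forall t \near 0^'+, ~ D (p + t *: d)).
Proof.
move=> cD bp [vv [e [n [g [sg vT]]]] vout].
have g0 := boundary_subgraph0 cD bp sg.
have [ee nn en _ _] := sg.
set c := derive1 g 0 in vT.
have vT' : dot v e = - c * dot v n.
  move: vT; rewrite !dotE !mxE => vT; apply/eqP; rewrite -subr_eq0.
  by rewrite -vT; apply/eqP; ring.
have vd u : dot v u = dot v n * (dot u n - c * dot u e).
  by rewrite (dot_frame v u ee nn en) vT'; ring.
have k0 : 0 < dot v n.
  rewrite ltNge; apply/negP => k0.
  have [+ _] := local_C1_subgraph_ray v sg g0; rewrite -/c => K.
  apply: near_right_contra vout; apply: K.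
  have := vv; rewrite vd => E.
  have : dot v n * (dot v n - c * dot v e) = 1 by [].
  rewrite -subr_lt0; case: (ltP (dot v n - c * dot v e) 0) => // h1 h2.
  by have := mulr_le0_ge0 k0 h1; rewrite h2 ler10.
have [K1 K2] := local_C1_subgraph_ray d sg g0.
split; rewrite vd.
  by rewrite pmulr_rlt0 // subr_lt0 => /K1.
by rewrite pmulr_rgt0 // subr_gt0 => /K2.
Qed.

Lemma is_outward_unit_normal_unique D p v w : closed D -> boundary D p ->
  is_outward_unit_normal D p v -> is_outward_unit_normal D p w -> v = w.
Proof.
move=> cD bp nv nw.
have [vv _ _] := nv; have [ww _ _] := nw.
have [Kv _] := is_outward_unit_normal_ray (w - v) cD bp nv.
have [_ Kw] := is_outward_unit_normal_ray (w - v) cD bp nw.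
have Ev : dot v (w - v) = dot v w - dot v v by rewrite !dotE !mxE; ring.
have Ew : dot w (w - v) = dot w w - dot v w by rewrite !dotE !mxE; ring.
have vw1 : 1 <= dot v w.
  rewrite leNgt; apply/negP => h.
  apply: (near_right_contra (Kv _) (Kw _)); first by rewrite Ev vv subr_lt0.
  by rewrite Ew ww subr_gt0.
have : dot (v - w) (v - w) <= 0.
  have -> : dot (v - w) (v - w) = dot v v + dot w w - 2 * dot v w.
    by rewrite !dotE !mxE; ring.
  by rewrite vv ww; lra.
rewrite dotE !mxE -!expr2 => h.
have := sqr_ge0 (v 0 0 - w 0 0); have := sqr_ge0 (v 0 1 - w 0 1) => h1 h0.
have /eqP : (v 0 0 - w 0 0) ^+ 2 = 0 by lra.
have /eqP : (v 0 1 - w 0 1) ^+ 2 = 0 by lra.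
by rewrite !sqrf_eq0 !subr_eq0 => /eqP h1' /eqP h0'; exact: rV2P.
Qed.

Lemma outward_unit_normal_spec D p : closed D -> C1_boundary D ->
  boundary D p -> is_outward_unit_normal D p (outward_unit_normal D p).
Proof.
move=> cD C1D bp; have [e [n [g sg]]] := C1D _ bp.
have g0 := boundary_subgraph0 cD bp sg.
have [ee nn en _ _] := sg.
set c := derive1 g 0.
have s0 : 0 < 1 + c ^+ 2 by rewrite ltr_wpDr // sqr_ge0.
set k := (Num.sqrt (1 + c ^+ 2))^-1.
have k0 : 0 < k by rewrite invr_gt0 sqrtr_gt0.
have kk : k * k * (1 + c ^+ 2) = 1.
  by rewrite -expr2 exprVn sqr_sqrtr ?ltW // mulVf // gt_eqF.
have dN u : dot (k *: (n - c *: e)) u = k * (dot u n - c * dot u e).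
  by rewrite !dotE !mxE; ring.
have ne : dot n e = 0 by rewrite -en !dotE; ring.
have vn : dot (k *: (n - c *: e)) n = k by rewrite dN nn ne; ring.
have ve : dot (k *: (n - c *: e)) e = - k * c by rewrite dN en ee; ring.
have vv : dot (k *: (n - c *: e)) (k *: (n - c *: e)) = 1.
  by rewrite dN vn ve -[RHS]kk; ring.
apply: (@xgetI _ 0 _ (k *: (n - c *: e))); split => //.
  exists e, n, g; split => //.
  have dD u : dot (e + c *: n) u = dot e u + c * dot n u.
    by rewrite !dotE !mxE; ring.
  by rewrite -/c dN !dD en nn ee ne; ring.
have [_] := local_C1_subgraph_ray (k *: (n - c *: e)) sg g0; apply.
rewrite -/c vn ve -subr_gt0.
have -> : k - c * (- k * c) = k * (1 + c ^+ 2) by ring.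
exact: mulr_gt0.
Qed.

End OutwardNormal.

(* Main.v *)
Require Import Defs.
From mathcomp Require Import all_boot all_order all_algebra.
From mathcomp Require Import all_classical all_reals all_analysis.
From mathcomp Require Import ring lra zify.

Import Order.TTheory GRing.Theory Num.Theory.
Import numFieldNormedType.Exports.

Local Open Scope classical_set_scope.
Local Open Scope ring_scope.

(** Why the theorem holds. Let Z be the zero set of F and suppose that G vanishes
nowhere on Z. Then Z is the disjoint union of the two compact sets Z+ and Z- on
which G is positive and negative. Since F points outward on the boundary of D,
the zeros of F(., s) have total degree 1 for each s. The degree carried by Z+ in
the slice at s does not depend on s, since Z+ stays away from Z- and from the
boundary. But F(., a) = F(., b) and G changes sign from s = a to s = b, so the
zeros belonging to Z+ at s = b are those belonging to Z- at s = a. The degree 1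
would thus be twice an integer.

The proof makes this degree combinatorial. Three ingredients carry it.

- The grid lemma [no_twisted_grid_labelling]. The plane domain is a square cut
  into small squares. The vertices of the grid carry the signs of the two
  components of F, and the degree of F on a small square is read off as the
  winding number of the four labels. This number vanishes as soon as one of the
  components has the same sign at the four vertices. The six faces of a cube
  have winding numbers of sum zero; this remains true after multiplying
  each of them by the indicator of G > 0, provided that each cube is so small
  that one of the two components of F or G has a constant sign on it. Summing
  over a layer of cubes gives the invariance in s of the degree carried by Z+.

- Compactness ([uniform_one_sign]): if the two components of F and G have no
  common zero, every cube of a fine enough grid is as above. This gives the
  theorem on a square ([twisted_miranda]), the outward condition being replaced
  by that of the Poincare-Miranda theorem: each component of F is negative on
  one side and positive on the opposite side.

- Passage from D to a square. With P the nearest-point projection onto D, put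
  F'(x, s) = F(P x, s) + (x - P x) and G'(x, s) = G(P x, s). Far from D the term
  x dominates, so F' satisfies the sign conditions on a large square. No zero
  of F' is outside D, because there F(P x, s) would be the opposite of an outer
  normal of D at P x ([outward_not_inner_normal]). *)

(** * Winding numbers on a labelled grid *)

(** A vertex is labelled by the signs of the two coordinates of a plane vector,
[true] meaning positive. An edge is counted when it crosses the positive half of
the second axis, with sign [+1] from left to right, that is, clockwise: winding
numbers are opposite to degrees. *)
Definition crossing (u v : bool * bool) : int :=
  u.2%:Z * v.2%:Z * (v.1%:Z - u.1%:Z).

Definition winding (p q r s : bool * bool) : int :=
  crossing p q + crossing q r + crossing r s + crossing s p.

Lemma winding_const1 p q r s :
  q.1 = p.1 -> r.1 = p.1 -> s.1 = p.1 -> winding p q r s = 0.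
Proof. by rewrite /winding /crossing => -> -> ->; rewrite !subrr !mulr0. Qed.

(** When the second signs are all [true], the crossings are the differences of a
function along a closed loop. *)
Lemma winding_const2 p q r s :
  q.2 = p.2 -> r.2 = p.2 -> s.2 = p.2 -> winding p q r s = 0.
Proof. by rewrite /winding /crossing => -> -> ->; ring. Qed.

Lemma telescope_sumr2l (f : nat -> nat -> int) (n : nat) :
  \sum_(0 <= i < n) \sum_(0 <= j < n) (f i.+1 j - f i j) =
  \sum_(0 <= j < n) (f n j - f 0%N j).
Proof.
by rewrite exchange_big; apply: eq_bigr => j _; rewrite telescope_sumr.
Qed.

Lemma telescope_sumr2r (f : nat -> nat -> int) (n : nat) :
  \sum_(0 <= i < n) \sum_(0 <= j < n) (f i j.+1 - f i j) =
  \sum_(0 <= i < n) (f i n - f i 0%N).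
Proof. by apply: eq_bigr => i _; rewrite telescope_sumr. Qed.

Lemma sumr2_eq (f g : nat -> nat -> int) (n : nat) :
  (forall i j, (i < n)%N -> (j < n)%N -> f i j = g i j) ->
  \sum_(0 <= i < n) \sum_(0 <= j < n) f i j =
  \sum_(0 <= i < n) \sum_(0 <= j < n) g i j.
Proof.
move=> fg; apply: eq_big_nat => i /andP[_ ltin].
by apply: eq_big_nat => j /andP[_ ltjn]; exact: fg.
Qed.

Section GridLabelling.
Variables (n m : nat) (al be ga : nat -> nat -> nat -> bool).

Definition const_on_cube (f : nat -> nat -> nat -> bool) i j k :=
  forall x y z : bool, f (i + x)%N (j + y)%N (k + z)%N = f i j k.

Definition const_on_square (f : nat -> nat -> bool) i j :=
  forall x y : bool, f (i + x)%N (j + y)%N = f i j.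

Hypothesis al0 : forall j k, (j <= n)%N -> (k <= m)%N -> al 0 j k = false.
Hypothesis aln : forall j k, (j <= n)%N -> (k <= m)%N -> al n j k = true.
Hypothesis be0 : forall i k, (i <= n)%N -> (k <= m)%N -> be i 0 k = false.
Hypothesis ben : forall i k, (i <= n)%N -> (k <= m)%N -> be i n k = true.
Hypothesis cube_const : forall i j k, (i < n)%N -> (j < n)%N -> (k < m)%N ->
  [\/ const_on_cube al i j k, const_on_cube be i j k | const_on_cube ga i j k].
Hypothesis al_periodic :
  forall i j, (i <= n)%N -> (j <= n)%N -> al i j m = al i j 0.
Hypothesis be_periodic :
  forall i j, (i <= n)%N -> (j <= n)%N -> be i j m = be i j 0.
(* On a square where both of the first two labels vary, the third one is reversed
between the two ends of the grid; on the others the winding number is zero. *)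
Hypothesis ga_flip : forall i j, (i < n)%N -> (j < n)%N ->
  [\/ const_on_square (fun x y => al x y 0%N) i j,
      const_on_square (fun x y => be x y 0%N) i j |
      ga i j m = ~~ ga i j 0].

Let l i j k := (al i j k, be i j k).

(* The faces are oriented by the cyclic order X, Y, Z of the axes, so that each
edge of a cube occurs twice, with opposite orientations. *)
Let faceX i j k :=
  winding (l i j k) (l i j.+1 k) (l i j.+1 k.+1) (l i j k.+1).
Let faceY i j k :=
  winding (l i j k) (l i j k.+1) (l i.+1 j k.+1) (l i.+1 j k).
Let faceZ i j k :=
  winding (l i j k) (l i.+1 j k) (l i.+1 j.+1 k) (l i j.+1 k).

Lemma cube_balance i j k :
  faceX i.+1 j k - faceX i j k + (faceY i j.+1 k - faceY i j k) +
  (faceZ i j k.+1 - faceZ i j k) = 0.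
Proof.
rewrite /faceX /faceY /faceZ /winding /crossing /l /=; ring.
Qed.

Let wX i j k := faceX i j k * (ga i j k)%:Z.
Let wY i j k := faceY i j k * (ga i j k)%:Z.
Let wZ i j k := faceZ i j k * (ga i j k)%:Z.

Lemma const_on_cubeE f i j k : const_on_cube f i j k ->
  [/\ f i.+1 j k = f i j k, f i j.+1 k = f i j k, f i j k.+1 = f i j k &
  [/\ f i.+1 j.+1 k = f i j k, f i.+1 j k.+1 = f i j k,
      f i j.+1 k.+1 = f i j k & f i.+1 j.+1 k.+1 = f i j k]].
Proof.
move=> c; split; [have := c true false false | have := c false true false |
  have := c false false true | split; [have := c true true false |
  have := c true false true | have := c false true true | have := c true true true]];
by rewrite ?addn1 ?addn0.
Qed.

(** The weight is constant on the cube unless all six winding numbers vanish. *)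
Lemma weighted_cube_balance i j k : (i < n)%N -> (j < n)%N -> (k < m)%N ->
  wZ i j k.+1 - wZ i j k =
  - (wX i.+1 j k - wX i j k) - (wY i j.+1 k - wY i j k).
Proof.
move=> ltin ltjn ltkm; apply/eqP; rewrite -subr_eq0; apply/eqP.
rewrite /wX /wY /wZ.
case: (cube_const _ _ _ ltin ltjn ltkm) => /const_on_cubeE
  [c100 c010 c001 [c110 c101 c011 c111]].
- by rewrite /faceX /faceY /faceZ !winding_const1 /= ?c100 ?c010 ?c001
    ?c110 ?c101 ?c011 ?c111 // !mul0r !subrr.
- by rewrite /faceX /faceY /faceZ !winding_const2 /= ?c100 ?c010 ?c001
    ?c110 ?c101 ?c011 ?c111 // !mul0r !subrr.
have := cube_balance i j k; rewrite c100 c010 c001.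
move: (faceX _ _ _) (faceX _ _ _) (faceY _ _ _) (faceY _ _ _) (faceZ _ _ _)
  (faceZ _ _ _) => x1 x0 y1 y0 z1 z0 e.
rewrite -[RHS](mul0r (ga i j k)%:Z) -e; ring.
Qed.

Let slice k := \sum_(0 <= i < n) \sum_(0 <= j < n) wZ i j k.

(** Homotopy invariance of the degree carried by the squares where the third
label is [true]: in the sum over a layer of cubes the lateral faces cancel in
pairs, and those on the boundary of the grid have a constant label. *)
Lemma slice_step k : (k < m)%N -> slice k.+1 = slice k.
Proof.
move=> ltkm; apply/eqP; rewrite -subr_eq0 /slice -sumrB.
under eq_bigr do rewrite -sumrB.
rewrite (sumr2_eq _ _ _ (fun i j hi hj => weighted_cube_balance i j k hi hj ltkm)).
under eq_bigr do rewrite sumrB sumrN.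
rewrite sumrB sumrN (telescope_sumr2l (fun i j => wX i j k))
  (telescope_sumr2r (fun i j => wY i j k)).
rewrite !big_nat !big1 ?oppr0 ?subrr // => i /andP[_ ltin].
  rewrite /wY /faceY !winding_const2 ?mul0r ?subrr //=;
  by rewrite ?ben ?be0 // ltnW.
rewrite /wX /faceX !winding_const1 ?mul0r ?subrr //=;
by rewrite ?aln ?al0 // ltnW.
Qed.

Lemma slice_const k : (k <= m)%N -> slice k = slice 0.
Proof. by elim: k => // k IH ltkm; rewrite slice_step // IH // ltnW. Qed.

(** Only the edges on the boundary of the grid remain in the sum. The second
label is [false] at the bottom and the first one is constant on each of the two
vertical sides, so only the top side contributes; it is traversed from right to
left, whence the sign. *)
Lemma total_winding :
  \sum_(0 <= i < n) \sum_(0 <= j < n) faceZ i j 0 = - 1.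
Proof.
pose hor i j := crossing (l i j 0) (l i.+1 j 0).
pose ver i j := crossing (l i j 0) (l i j.+1 0).
have E i j : faceZ i j 0 = (ver i.+1 j - ver i j) - (hor i j.+1 - hor i j).
  by rewrite /faceZ /hor /ver /winding /crossing /=; ring.
under eq_bigr do under eq_bigr do rewrite E.
under eq_bigr do rewrite sumrB.
rewrite sumrB telescope_sumr2l telescope_sumr2r.
rewrite big_nat big1 ?sub0r => [|j /andP[_ ltjn]]; last first.
  by rewrite /ver /crossing /= !aln ?al0 ?subrr ?mulr0 // ltnW.
rewrite (_ : \sum_(0 <= i < n) _ =
    \sum_(0 <= i < n) ((al i.+1 n 0)%:Z - (al i n 0)%:Z)).
  by rewrite (telescope_sumr (fun i => (al i n 0)%:Z)) // aln ?al0.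
apply: eq_big_nat => i /andP[_ ltin].
by rewrite /hor /crossing /= !ben ?be0 ?(ltnW ltin) //= !mul1r !mul0r subr0.
Qed.

(** If [w] is the sum of the winding numbers of the squares of the bottom slice
whose third label is [true], the
reversal of that label gives [w = - 1 - w], which no integer satisfies. *)
Lemma no_twisted_grid_labelling : False.
Proof.
have flip : slice m = \sum_(0 <= i < n) \sum_(0 <= j < n) faceZ i j 0 - slice 0.
  rewrite /slice -sumrB; under [RHS]eq_bigr do rewrite -sumrB.
  apply: sumr2_eq => i j ltin ltjn.
  have -> : wZ i j m = faceZ i j 0 * (ga i j m)%:Z.
    by rewrite /wZ /faceZ /l !al_periodic ?be_periodic // ltnW.
  rewrite /wZ; case: (ga_flip _ _ ltin ltjn) => [c|c|->].
  - have := (c true false, c false true, c true true).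
    rewrite !addn0 !addn1 => -[[c10 c01] c11].
    by rewrite /faceZ winding_const1 // !mul0r.
  - have := (c true false, c false true, c true true).
    rewrite !addn0 !addn1 => -[[c10 c01] c11].
    by rewrite /faceZ winding_const2 // !mul0r.
  - by case: (ga i j 0) => /=; ring.
by move: flip; rewrite slice_const // total_winding; lia.
Qed.

End GridLabelling.

(** * The theorem on a square *)

Section TwistedMiranda.
Set Implicit Arguments.
Unset Strict Implicit.
Variable R : realType.

Definition one_sign (T : pseudoMetricType R) (K : set T) (f : T -> R)
    (p : T) (e : R) :=
  (forall q, K q -> ball p e q -> 0 < f q) \/
  (forall q, K q -> ball p e q -> f q < 0).

Lemma one_signP (T : pseudoMetricType R) (K : set T) (f : T -> R) p e :
  one_sign K f p e -> forall q q', K q -> K q' -> ball p e q -> ball p e q' ->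
  (0 < f q) = (0 < f q') /\ f q != 0.
Proof.
move=> [H|H] q q' Kq Kq' /(H _ Kq) Hq /(H _ Kq') Hq'; split.
- by apply/idP/idP.
- by rewrite gt_eqF.
- by rewrite (lt_gtF Hq) (lt_gtF Hq').
- by rewrite lt_eqF.
Qed.

Lemma near_one_sign (T : pseudoMetricType R) (K : set T) (f : T -> R) p :
  {within K, continuous f} -> K p -> f p != 0 ->
  \forall p' \near p & e \near (0 : R)^'+, one_sign K f p' e.
Proof.
move=> /subspace_continuousP cf Kp fp0.
suff [r r0 Hr] : exists2 r, 0 < r & one_sign K f p r.
  exists (ball p (r / 2), [set e | e < r / 2]) => /=.
    split; first by apply: nbhsx_ballx; lra.
    by apply: nbhs_right_lt; lra.
  move=> [p' e] /= [pp' er].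
  have sub q : ball p' e q -> ball p r q.
    move=> p'q; rewrite (_ : r = r / 2 + r / 2); last by lra.
    by apply: ball_triangle pp' _; apply: le_ball p'q; exact: ltW.
  by case: Hr => Hr; [left|right] => q Kq /sub; exact: Hr.
have [fpp|fpn] := ltP 0 (f p).
  have /nbhs_ballP[r /= r0 Hr] : nbhs p [set q | K q -> 0 < f q].
    exact: cvgr_gt _ (cf p Kp) _ fpp.
  by exists r => //; left => q Kq pq; exact: Hr.
have {}fpn : f p < 0 by rewrite lt_neqAle fp0.
have /nbhs_ballP[r /= r0 Hr] : nbhs p [set q | K q -> f q < 0].
    exact: cvgr_lt _ (cf p Kp) _ fpn.
by exists r => //; right => q Kq pq; exact: Hr.
Qed.

(** A Lebesgue number for the cover of [K] by the open sets on which one of the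
three functions has a constant sign. *)
Lemma uniform_one_sign (T : pseudoMetricType R) (K : set T) (f g h : T -> R) :
  compact K -> {within K, continuous f} -> {within K, continuous g} ->
  {within K, continuous h} ->
  (forall p, K p -> [\/ f p != 0, g p != 0 | h p != 0]) ->
  exists2 e, 0 < e & forall p, K p ->
    [\/ one_sign K f p e, one_sign K g p e | one_sign K h p e].
Proof.
move=> /compact_near_coveringP cK cf cg ch fgh.
have := cK R (0 : R)^'+ (fun e p =>
  [\/ one_sign K f p e, one_sign K g p e | one_sign K h p e]) _.
move=> H.
have {}H : \forall e \near (0 : R)^'+, 0 < e /\ forall p, K p ->
    [\/ one_sign K f p e, one_sign K g p e | one_sign K h p e].
  near=> e; split; first by near: e; exact: nbhs_right_gt.
  near: e; apply: H => p Kp.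
  case: (fgh p Kp) => p0.
  - by apply: filterS (near_one_sign cf Kp p0) => -[? ?] ?; apply: Or31.
  - by apply: filterS (near_one_sign cg Kp p0) => -[? ?] ?; apply: Or32.
  - by apply: filterS (near_one_sign ch Kp p0) => -[? ?] ?; apply: Or33.
by have [e [e0 He]] := filter_ex H; exists e.
Unshelve. all: by end_near. Qed.

Definition node (u v : R) (n i : nat) : R := u + (v - u) * (i%:R / n%:R).

Lemma node0 u v n : node u v n 0 = u.
Proof. by rewrite /node mul0r mulr0 addr0. Qed.

Lemma noden u v n : (0 < n)%N -> node u v n n = v.
Proof.
move=> n0; have n0' : n%:R != 0 :> R by rewrite pnatr_eq0 -lt0n.
by rewrite /node divff // mulr1 addrC subrK.
Qed.

Lemma node_itv u v n i : u <= v -> (i <= n)%N -> node u v n i \in `[u, v].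
Proof.
move=> uv lein; rewrite in_itv /= /node.
have t0 : 0 <= i%:R / n%:R :> R by rewrite divr_ge0.
have t1 : i%:R / n%:R <= 1 :> R.
  case: n lein {t0} => [|n] lein; first by rewrite invr0 mulr0.
  by rewrite ler_pdivrMr ?ltr0n // mul1r ler_nat.
by apply/andP; split; nra.
Qed.

Lemma node_ball u v n i (x : bool) e : u <= v -> 0 < e -> (v - u) / e < n%:R ->
  ball (node u v n i) e (node u v n (i + x)).
Proof.
move=> uv e0 ne; have n0 : 0 < n%:R :> R.
  by apply: le_lt_trans ne; rewrite divr_ge0 // ?subr_ge0 // ltW.
rewrite -ball_normE /= /node natrD.
have -> : u + (v - u) * (i%:R / n%:R) -
    (u + (v - u) * ((i%:R + x%:R) / n%:R)) =
  - ((v - u) / n%:R * x%:R) by ring.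
have H : (v - u) / n%:R < e by rewrite ltr_pdivrMr // mulrC -ltr_pdivrMr.
have H0 : 0 <= (v - u) / n%:R by rewrite divr_ge0 ?subr_ge0.
have H1 : 0 <= (v - u) / n%:R * x%:R :> R.
  by apply: mulr_ge0 => //; exact: ler0n.
by rewrite normrN ger0_norm //; case: (x); rewrite ?mulr1 ?mulr0.
Qed.

(** The sides of the square satisfy the conditions of the Poincare-Miranda
theorem for [f] and [g]. The grid lemma applies to the signs of the three
functions on a grid finer than the Lebesgue number. *)
Lemma twisted_miranda (c d a b : R) (f g h : R * R * R -> R) :
  let K := `[c, d]%classic `*` `[c, d]%classic `*` `[a, b]%classic in
  c < d -> a < b ->
  {within K, continuous f} -> {within K, continuous g} ->
  {within K, continuous h} ->
  (forall y s, y \in `[c, d] -> s \in `[a, b] ->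
     f (c, y, s) < 0 /\ 0 < f (d, y, s)) ->
  (forall x s, x \in `[c, d] -> s \in `[a, b] ->
     g (x, c, s) < 0 /\ 0 < g (x, d, s)) ->
  (forall x y, x \in `[c, d] -> y \in `[c, d] ->
     [/\ f (x, y, b) = f (x, y, a), g (x, y, b) = g (x, y, a) &
      h (x, y, a) != 0 -> h (x, y, a) * h (x, y, b) < 0]) ->
  exists p, [/\ K p, f p = 0, g p = 0 & h p = 0].
Proof.
move=> K cd ab cf cg ch fout gout per; apply: contrapT => nozero.
have cK : compact K.
  by apply: compact_setX; [apply: compact_setX|]; exact: segment_compact.
have [|e e0 He] := uniform_one_sign cK cf cg ch.
  move=> p Kp; have [f0|f0] := eqVneq (f p) 0; last exact: Or31.
  have [g0|g0] := eqVneq (g p) 0; last exact: Or32.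
  have [h0|h0] := eqVneq (h p) 0; last exact: Or33.
  by exfalso; apply: nozero; exists p.
have cdW := ltW cd; have abW := ltW ab.
(* A common number of steps, fine enough for both intervals. *)
pose n := (Num.Def.archi_bound ((d - c) / e) +
  Num.Def.archi_bound ((b - a) / e))%N.
have cdn : (d - c) / e < n%:R.
  apply: lt_le_trans (archi_boundP _) _; last by rewrite ler_nat leq_addr.
  by rewrite divr_ge0 ?subr_ge0 // ltW.
have abn : (b - a) / e < n%:R.
  apply: lt_le_trans (archi_boundP _) _; last by rewrite ler_nat leq_addl.
  by rewrite divr_ge0 ?subr_ge0 // ltW.
have n0 : (0 < n)%N.
  by rewrite -(ltr_nat R); apply: lt_trans cdn; rewrite divr_gt0 ?subr_gt0.
pose x := node c d n; pose s := node a b n.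
have xI i : (i <= n)%N -> x i \in `[c, d] by exact: node_itv.
have sI k : (k <= n)%N -> s k \in `[a, b] by exact: node_itv.
pose pt i j k := (x i, x j, s k).
have Kpt i j k : (i <= n)%N -> (j <= n)%N -> (k <= n)%N -> K (pt i j k).
  by move=> hi hj hk; split; [split|]; [exact: xI|exact: xI|exact: sI].
have Bpt i j k (u v w : bool) :
    ball (pt i j k) e (pt (i + u) (j + v) (k + w))%N.
  by split; [split|]; exact: node_ball.
pose lab (q : R * R * R -> R) i j k := 0 < q (pt i j k).
have le1 i (u : bool) : (i < n)%N -> (i + u <= n)%N by case: u; lia.
have labP q i j k : one_sign K q (pt i j k) e ->
    (i < n)%N -> (j < n)%N -> (k < n)%N -> const_on_cube (lab q) i j k.
  move=> osq hi hj hk u v w.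
  have K1 := Kpt _ _ _ (le1 _ u hi) (le1 _ v hj) (le1 _ w hk).
  have K0 := Kpt _ _ _ (ltnW hi) (ltnW hj) (ltnW hk).
  by have [] := one_signP osq K1 K0 (Bpt _ _ _ _ _ _) (ballxx _ e0).
have s0 : s 0 = a by exact: node0.
have sn : s n = b by exact: noden.
apply: (@no_twisted_grid_labelling n n (lab f) (lab g) (lab h)).
- move=> j k hj hk; rewrite /lab /pt /x node0.
  by apply/negbTE; rewrite -leNgt ltW //; have [] := fout _ _ (xI _ hj) (sI _ hk).
- move=> j k hj hk; rewrite /lab /pt {1}/x noden //.
  by have [] := fout _ _ (xI _ hj) (sI _ hk).
- move=> j k hj hk; rewrite /lab /pt /x node0.
  by apply/negbTE; rewrite -leNgt ltW //; have [] := gout _ _ (xI _ hj) (sI _ hk).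
- move=> j k hj hk; rewrite /lab /pt {2}/x noden //.
  by have [] := gout _ _ (xI _ hj) (sI _ hk).
- move=> i j k hi hj hk.
  case: (He (pt i j k)) => [|o|o|o]; first by apply: Kpt; exact: ltnW.
  + by apply: Or31; exact: labP.
  + by apply: Or32; exact: labP.
  + by apply: Or33; exact: labP.
- move=> i j hi hj; rewrite /lab /pt sn s0.
  by have [-> _ _] := per _ _ (xI _ hi) (xI _ hj).
- move=> i j hi hj; rewrite /lab /pt sn s0.
  by have [_ -> _] := per _ _ (xI _ hi) (xI _ hj).
move=> i j hi hj.
case: (He (pt i j 0)) => [|o|o|o]; first by apply: Kpt => //; exact: ltnW.
- by apply: Or31 => u v; exact: (labP _ _ _ _ o hi hj n0 u v false).
- by apply: Or32 => u v; exact: (labP _ _ _ _ o hi hj n0 u v false).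
- apply: Or33; rewrite /lab /pt sn s0.
  have [_ _] := per _ _ (xI _ (ltnW hi)) (xI _ (ltnW hj)).
  have Kp := Kpt i j 0%N (ltnW hi) (ltnW hj) isT.
  have [_] := one_signP o Kp Kp (ballxx _ e0) (ballxx _ e0).
  rewrite /pt s0 => h0 /(_ h0) hh; apply/idP/idP => hb.
    by rewrite -leNgt leNgt; apply/negP => ha; have := mulr_gt0 ha hb; lra.
  have ha : h (x i, x j, a) < 0 by rewrite lt_neqAle h0 leNgt.
  by rewrite -(nmulr_rlt0 _ ha).
Qed.

End TwistedMiranda.

(** * Nearest-point projection onto a convex body *)

Section MetricProjection.
Variable R : realType.
Set Implicit Arguments.
Unset Strict Implicit.
Implicit Types (D : set 'rV[R]_2) (p q u v x y : 'rV[R]_2).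

Lemma dotNl u x : dot (- u) x = - dot u x.
Proof. by rewrite !dotE !mxE; ring. Qed.

Lemma dotZr (t : R) u x : dot u (t *: x) = t * dot u x.
Proof. by rewrite !dotE !mxE; ring. Qed.

Lemma dotC u v : dot u v = dot v u.
Proof. by rewrite !dotE; ring. Qed.

Lemma dot_ge0 u : 0 <= dot u u.
Proof. by rewrite dotE -!expr2 addr_ge0 // sqr_ge0. Qed.

Lemma dot_le0_eq0 u : dot u u <= 0 -> u = 0.
Proof.
rewrite dotE -!expr2 => h.
have := sqr_ge0 (u 0 0); have := sqr_ge0 (u 0 1) => h1 h0.
by apply: rV2P; rewrite mxE; apply/eqP; rewrite -sqrf_eq0; apply/eqP; lra.
Qed.

Lemma coord_le_norm u i : `|u 0 i| <= `|u|.
Proof.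
by rewrite [leRHS]/Num.norm /= mx_normrE; apply/bigmax_geP; right => /=;
  exists (0, i).
Qed.

Lemma dot_continuous_dist x : continuous (fun p => dot (x - p) (x - p)).
Proof.
have -> : (fun p => dot (x - p) (x - p)) = (fun p : 'rV[R]_2 =>
    (x 0 0 - p 0 0) * (x 0 0 - p 0 0) + (x 0 1 - p 0 1) * (x 0 1 - p 0 1)).
  by apply/funext => p; rewrite dotE !mxE.
move=> p.
have c i : (fun p : 'rV[R]_2 => x 0 i - p 0 i) @ p --> x 0 i - p 0 i.
  have c1 : (fun p : 'rV[R]_2 => p 0 i) @ p --> p 0 i by exact: coord_continuous.
  have c2 : (fun _ : 'rV[R]_2 => x 0 i) @ p --> x 0 i.
    exact: (@cvg_cst R (x 0 i) _ (nbhs p)).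
  exact: cvgB c2 c1.
exact: cvgD (cvgM (c 0) (c 0)) (cvgM (c 1) (c 1)).
Qed.

Lemma convex_segment D p y (t : R) : convex_set (M := 'rV[R]_2) D ->
  D p -> D y -> 0 <= t -> t <= 1 -> D (p + t *: (y - p)).
Proof.
move=> cD Dp Dy t0 t1.
have -> : p + t *: (y - p) = t *: y + (1 - t) *: p.
  by rewrite scalerBr scalerBl scale1r addrCA.
exact: set_mem (cD y p (Itv01 t0 t1) (mem_set Dy) (mem_set Dp)).
Qed.

(** The nearest point of a convex set is the one seen at an obtuse angle from
[x] and every other point of the set; this inequality is what the later
arguments use. *)
Definition is_projection D x p :=
  D p /\ forall y, D y -> dot (x - p) (y - p) <= 0.

Lemma projection_exists D x : D !=set0 -> compact D ->
  convex_set (M := 'rV[R]_2) D -> exists p, is_projection D x p.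
Proof.
move=> D0 kD cD.
have cd : {within D, continuous (fun p => dot (x - p) (x - p))}.
  by apply: continuous_subspaceT; exact: dot_continuous_dist.
have [p /set_mem Dp pmin] := compact_EVT_min D0 kD cd.
exists p; split => // y Dy; rewrite leNgt; apply/negP => h.
set A := dot (x - p) (y - p) in h; set B := dot (y - p) (y - p).
have B0 : 0 <= B by exact: dot_ge0.
(* Moving from [p] towards [y] by the fraction [t] changes the squared distance
to [x] by [- t * (2 * A - t * B)]; the choice of [t] below keeps [t <= 1] and
makes this negative. *)
have AB : 0 < A + B by lra.
set t := A / (A + B).
have t0 : 0 < t by rewrite divr_gt0.
have t1 : t <= 1 by rewrite ler_pdivrMr // mul1r; lra.
have := pmin _ (mem_set (convex_segment cD Dp Dy (ltW t0) t1)).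
have -> : dot (x - (p + t *: (y - p))) (x - (p + t *: (y - p))) =
  dot (x - p) (x - p) - t * (2 * A - t * B).
  by rewrite /A /B !dotE !mxE; ring.
apply/negP; rewrite -ltNge ltrBlDr ltrDl mulr_gt0 //.
have tAB : t * (A + B) = A by rewrite /t divfK // gt_eqF.
nra.
Qed.

Definition projection D x : 'rV[R]_2 := xget 0 (is_projection D x).

(** If [u = - n], then [n] has a negative product with the outward normal, so
the ray from [p] along [n] starts inside [D]; as [n] is an outer normal of [D]
at [p] in the sense of convexity, it has to vanish, and then so does [u]. *)
Lemma outward_not_inner_normal D p u n : C1_boundary D -> closed D ->
  boundary D p -> 0 < dot u (outward_unit_normal D p) ->
  (forall y, D y -> dot n (y - p) <= 0) -> u + n <> 0.
Proof.
move=> C1D clD bp uv nD /eqP; rewrite addr_eq0 => /eqP un.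
have [+ _] := is_outward_unit_normal_ray n clD bp
  (outward_unit_normal_spec clD C1D bp).
have nv : dot (outward_unit_normal D p) n < 0.
  by move: uv; rewrite un dotNl oppr_gt0 dotC.
move=> /(_ nv) nr.
have H : \forall t \near (0 : R)^'+, 0 < t /\ D (p + t *: n).
  near=> t; split; first by near: t; exact: nbhs_right_gt.
  by near: t.
have [t [t0 /nD]] := filter_ex H.
rewrite [p + _]addrC addrK dotZr pmulr_rle0 // => /dot_le0_eq0 n0.
by move: uv; rewrite un n0 oppr0 dotE !mxE !mul0r addr0 ltxx.
Unshelve. all: by end_near. Qed.

Section ConvexBody.
Variable D : set 'rV[R]_2.
Hypotheses (D0 : D !=set0) (kD : compact D)
  (cD : convex_set (M := 'rV[R]_2) D).

Lemma projectionP x : is_projection D x (projection D x).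
Proof.
by have [p Dp] := projection_exists x D0 kD cD; exact: (@xgetI _ 0 _ p).
Qed.

Lemma projection_id x : D x -> projection D x = x.
Proof.
move=> Dx; have [_ /(_ _ Dx)/dot_le0_eq0/eqP] := projectionP x.
by rewrite subr_eq0 => /eqP.
Qed.

Lemma projection_nonexpansive x y :
  dot (projection D x - projection D y) (projection D x - projection D y) <=
  dot (x - y) (x - y).
Proof.
have [Dp px] := projectionP x; have [Dq qy] := projectionP y.
have := px _ Dq; have := qy _ Dp.
set p := projection D x; set q := projection D y.
have := dot_ge0 ((x - y) - (p - q)).
by rewrite !dotE !mxE; nra.
Qed.

Lemma projection_continuous : continuous (projection D).
Proof.
move=> x; apply: (proj2 (@cvg_ballP R 'rV[R]_2 _ (nbhs x) _ (projection D) _)) => e e0.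
near=> y.
have : ball x (e / 2) y by near: y; apply: nbhsx_ballx; lra.
move=> [_ xy].
have {}xy i : `|x 0 i - y 0 i| < e / 2 by have := xy 0 i; rewrite -ball_normE.
have := projection_nonexpansive x y; have := xy 0; have := xy 1.
set p := projection D x; set q := projection D y.
rewrite !dotE !mxE !ltr_norml => /andP[a1 a2] /andP[b1 b2] h.
have : (p 0 0 - q 0 0) ^+ 2 + (p 0 1 - q 0 1) ^+ 2 < e ^+ 2 by nra.
have := sqr_ge0 (p 0 0 - q 0 0); have := sqr_ge0 (p 0 1 - q 0 1) => h1 h0 hs.
have H (z : R) : z ^+ 2 < e ^+ 2 -> `|z| < e.
  by move=> ze; rewrite -(ltr_pXn2r (n := 2)) ?nnegrE ?(ltW e0) //
    real_normK ?num_real.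
split => // i j; rewrite (ord1 i) -ball_normE /=.
case: j => -[|[|//]] hj.
- by rewrite (_ : Ordinal hj = 0); [apply: H; lra|exact: val_inj].
- by rewrite (_ : Ordinal hj = 1); [apply: H; lra|exact: val_inj].
Unshelve. all: by end_near. Qed.

(** At an interior point of [D] one could move further towards [x]. *)
Lemma projection_boundary x : ~ D x -> boundary D (projection D x).
Proof.
move=> nDx; have [Dp px] := projectionP x.
split; first exact: subset_closure.
set p := projection D x in Dp px *.
rewrite /interior /= => iD.
have c : (fun t : R => p + t *: (x - p)) @ 0^'+ --> p.
  apply: cvg_at_right_filter.
  suff : (fun t : R => p + t *: (x - p)) @ (0 : R) --> p + 0 *: (x - p).
    by rewrite scale0r addr0.
  apply: cvgD; first exact: cvg_cst.
  by apply: (@cvgZr_tmp R 'rV[R]_2 R (nbhs (0 : R)) _ id 0 _); exact: cvg_id.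
have H : \forall t \near (0 : R)^'+, 0 < t /\ D (p + t *: (x - p)).
  near=> t; split; first by near: t; exact: nbhs_right_gt.
  by near: t; exact: c iD.
have [t [t0 /px]] := filter_ex H.
rewrite [p + _]addrC addrK dotZr pmulr_rle0 // => /dot_le0_eq0/eqP.
by rewrite subr_eq0 => /eqP xp; apply: nDx; rewrite xp.
Unshelve. all: by end_near. Qed.

End ConvexBody.
End MetricProjection.

(** * From a convex body to a square *)

Lemma within_continuous_factor (U V W : topologicalType) (A : set U) (B : set V)
    (f : U -> V) (g : V -> W) :
  continuous f -> (forall x, A x -> B (f x)) -> {within B, continuous g} ->
  {within A, continuous (g \o f)}.
Proof.
move=> cf AB /subspace_continuousP cg; apply/subspace_continuousP => x Ax N gN.
have /= Hg := cg _ (AB _ Ax) N gN.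
have : nbhs x (fun y => B (f y) -> N (g (f y))) by exact: cf Hg.
by apply: filterS => y Hy Ay; apply: Hy; exact: AB.
Qed.

Section ConvexBodyExtension.
Set Implicit Arguments.
Unset Strict Implicit.
Variable R : realType.

Lemma compact_domain_compact (D : set 'rV[R]_2) : compact_domain D ->
  [/\ D !=set0, closed D & compact D].
Proof.
move=> [U [[u Uu] Ub _ _ ->]].
have clU : closed (closure U) by exact: closed_closure.
split => //; first by exists u; exact: subset_closure.
apply: bounded_closed_compact => //.
have [M M0 UM] := pinfty_ex_gt0 Ub.
have cM : closed [set x : 'rV[R]_2 | `|x| <= M].
  apply: (@closed_comp _ _ (fun x : 'rV[R]_2 => `|x|) [set r | r <= M]).
    by move=> x _; exact: norm_continuous.
  exact: closed_le.
exists M; split; first exact: gtr0_real.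
move=> N MN x clx; apply: le_trans (ltW MN).
by apply: cM; apply: closureS clx => y /UM.
Qed.

Definition plane_point (x y : R) : 'rV[R]_2 :=
  x *: delta_mx 0 0 + y *: delta_mx 0 1.

Lemma plane_point0 x y : plane_point x y 0 0 = x.
Proof. by rewrite /plane_point !mxE /= mulr1 mulr0 addr0. Qed.

Lemma plane_point1 x y : plane_point x y 0 1 = y.
Proof. by rewrite /plane_point !mxE /= mulr1 mulr0 add0r. Qed.

Lemma plane_point_continuous :
  continuous (fun q : R * R * R => plane_point q.1.1 q.1.2).
Proof.
move=> q.
have c1 : (fun q : R * R * R => q.1.1) @ q --> q.1.1.
  by apply: cvg_comp; exact: cvg_fst.
have c2 : (fun q : R * R * R => q.1.2) @ q --> q.1.2.
  by apply: cvg_comp; [exact: cvg_fst|exact: cvg_snd].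
have d1 := @cvgZr_tmp R 'rV[R]_2 _ (nbhs q) (nbhs_filter q) _ _ (delta_mx 0 0) c1.
have d2 := @cvgZr_tmp R 'rV[R]_2 _ (nbhs q) (nbhs_filter q) _ _ (delta_mx 0 1) c2.
exact: cvgD d1 d2.
Qed.

End ConvexBodyExtension.

Theorem theorem2p2 (R : realType) (D : set 'rV[R]_2) (a b : R)
    (F : 'rV[R]_2 * R -> 'rV[R]_2) (G : 'rV[R]_2 * R -> R)
    (D_domain : compact_domain D)
    (D_convex : convex_set (M := 'rV[R]_2) D)
    (D_C1 : C1_boundary D)
    (ab : a < b)
    (F_cont : {within D `*` `[a, b], continuous F})
    (G_cont : {within D `*` `[a, b], continuous G})
    (F_outward : forall x s, boundary D x -> s \in `[a, b] ->
       0 < dot (F (x, s)) (outward_unit_normal D x))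
    (F_periodic : forall x, D x -> F (x, a) = F (x, b))
    (G_zero : forall x, D x -> G (x, a) = 0 -> G (x, b) = 0)
    (G_sign : forall x, D x -> G (x, a) != 0 -> G (x, a) * G (x, b) < 0) :
  exists (x : 'rV[R]_2) (s : R),
    [/\ D x, s \in `[a, b], F (x, s) = 0 & G (x, s) = 0].
Proof.
have [D0 clD kD] := compact_domain_compact D_domain.
set P := projection D.
have PD x : D (P x) by have [] := projectionP D0 kD D_convex x.
have Pn x y : D y -> dot (x - P x) (y - P x) <= 0.
  by have [_ /(_ y)] := projectionP D0 kD D_convex x.
have cP : continuous P by exact: projection_continuous.
pose F' (q : 'rV[R]_2 * R) := F (P q.1, q.2) + (q.1 - P q.1).
have F'E q i : F' q 0 i = F (P q.1, q.2) 0 i + (q.1 0 i - P q.1 0 i).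
  suff coordDB (u v w : 'rV[R]_2) : (u + (v - w)) 0 i = u 0 i + (v 0 i - w 0 i).
    exact: coordDB.
  by rewrite !mxE.
have F'_zero x s : s \in `[a, b] -> F' (x, s) = 0 -> D x.
  move=> sab F'0; apply: contrapT => nDx; move: F'0.
  have bPx := projection_boundary D0 kD D_convex nDx.
  by apply: (outward_not_inner_normal D_C1 clD bPx) => //;
    [exact: F_outward|exact: Pn].
(* On the sides of the square [- L, L]^2 the coordinate x i dominates. *)
have [L L0 HL] : exists2 L, 0 < L &
    forall p s i, D p -> s \in `[a, b] -> `|F (p, s) 0 i - p 0 i| < L.
  have kK : compact (D `*` `[a, b]).
    by apply: compact_setX => //; exact: segment_compact.
  have [M M0 HM] :=
    pinfty_ex_gt0 (compact_bounded (continuous_compact F_cont kK)).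
  have [N N0 HN] := pinfty_ex_gt0 (compact_bounded kD).
  exists (M + N + 1); first by lra.
  move=> p s i Dp sab.
  have h1 : `|F (p, s) 0 i| <= M.
    by apply: le_trans (coord_le_norm _ _) _; apply: HM; exists (p, s).
  have h2 : `|p 0 i| <= N by apply: le_trans (coord_le_norm _ _) _; exact: HN.
  by have := ler_normB (F (p, s) 0 i) (p 0 i); lra.
have F'L x s i : s \in `[a, b] -> `|F' (x, s) 0 i - x 0 i| < L.
  move=> /(HL (P x) s i (PD x)).
  by rewrite F'E /= addrCA -addrA addrCA subrr addr0 addrC.
pose K := `[- L, L]%classic `*` `[- L, L]%classic `*` `[a, b]%classic.
pose pt (q : R * R * R) := (plane_point q.1.1 q.1.2, q.2).
pose rt (q : R * R * R) := (P (plane_point q.1.1 q.1.2), q.2).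
have cPp : continuous (fun q : R * R * R => P (plane_point q.1.1 q.1.2)).
  by move=> q; apply: continuous_comp; [exact: plane_point_continuous|exact: cP].
have crt : continuous rt.
  by move=> q; exact: (cvg_pair (cPp q) (@cvg_snd _ _ (nbhs q.1) (nbhs q.2) _)).
have rtK q : K q -> (D `*` `[a, b]) (rt q) by move=> [_ qs]; split => //; exact: PD.
have cG : {within K, continuous (G \o rt)}.
  exact: within_continuous_factor crt rtK G_cont.
have cF : {within K, continuous (F \o rt)}.
  exact: within_continuous_factor crt rtK F_cont.
have cF' i : {within K, continuous (fun q => F' (pt q) 0 i)}.
  apply/subspace_continuousP => q Kq.
  have cc (h : R * R * R -> 'rV[R]_2) : h @ within K (nbhs q) --> h q ->
      (fun q => h q 0 i) @ within K (nbhs q) --> h q 0 i.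
    by move=> ch; exact: (cvg_comp _ _ ch (@coord_continuous R 1 2 0 i _)).
  have d1 : (F \o rt) @ within K (nbhs q) --> (F \o rt) q.
    by move/subspace_continuousP : cF; exact.
  have d2 : (fun q : R * R * R => plane_point q.1.1 q.1.2) @ within K (nbhs q) -->
      plane_point q.1.1 q.1.2.
    by apply: cvg_within_filter; exact: plane_point_continuous.
  have d3 : (fun q : R * R * R => P (plane_point q.1.1 q.1.2)) @ within K (nbhs q) -->
      P (plane_point q.1.1 q.1.2).
    by apply: cvg_within_filter; exact: cPp.
  exact: (cc (fun q => F' (pt q)) (cvgD d1 (cvgB d2 d3))).
have LL : - L < L by lra.
have [|||[[x y] s]] := twisted_miranda LL ab (cF' 0) (cF' 1) cG.
- move=> y s _ sab; split.
    have := F'L (plane_point (- L) y) s 0 sab.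
    by rewrite (plane_point0 (- L) y) ltr_norml => /andP[_]; rewrite ltrBlDr subrr.
  have := F'L (plane_point L y) s 0 sab.
  by rewrite (plane_point0 L y) ltr_norml => /andP[+ _]; rewrite ltrBrDr addNr.
- move=> x s _ sab; split.
    have := F'L (plane_point x (- L)) s 1 sab.
    by rewrite (plane_point1 x (- L)) ltr_norml => /andP[_]; rewrite ltrBlDr subrr.
  have := F'L (plane_point x L) s 1 sab.
  by rewrite (plane_point1 x L) ltr_norml => /andP[+ _]; rewrite ltrBrDr addNr.
- move=> x y _ _; rewrite /F' /pt /rt /= F_periodic //.
  by split => //; exact: G_sign.
move=> [[_ sab]]; rewrite /pt /rt /= => F'0 F'1 G0.
have sab' : s \in `[a, b] by [].
have F'xy0 : F' (plane_point x y, s) = 0 by apply: rV2P; rewrite ?F'0 ?F'1 mxE.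
have Dx := F'_zero _ _ sab' F'xy0.
have PE : P (plane_point x y) = plane_point x y by exact: projection_id.
exists (plane_point x y), s; split => //; last by rewrite PE in G0.
by move: F'xy0; rewrite /F' /= PE subrr addr0.
Qed.
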